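(* Let $L$ be an atomless frame with pointless part $E$. (1) If $x$ is a proper regular filter on $L$ then $\pi_L(x)$ is a proper regular filter on $E$. (2) If $x$ is a maximal proper round filter on $L$ then $\pi_L(x)$ is a proper regular filter on $E$. (3) If $A$ is a subset of $\max L$ then $\{\pi_L(x_a):a\in A\}$ is an independent family of proper regular filters on $E$.
   Context: All frames are completely regular. $\max L$ is the set of maximal elements of $L\setminus\{\top\}$. An element $c$ is a successor of $a$ if $c>a$ and there is no $b$ with $a<b<c$; an atom is a successor of $\bot$. The pointless part of $L$ is the sublocale $E=\pi L=\{a\in L:a\text{ has no successor}\}$, with quotient map $\pi_L:L\to E$, $\pi_L(b)=\bigwedge\{a\in\pi L:a\ge b\}$. For $a\in\max L$, $x_a=\{b\in L:b\nleq a\}$. A filter $x$ on a frame is proper if $\bot\notin x$; round if for every $a\in x$ there is $b\in x$ completely below $a$; regular if it is round and $\bigvee_{b\in x}b^*=\top$. A maximal proper round filter is one that is maximal among proper round filters. A family of filters is independent if any two distinct members contain disjoint elements. $\pi_L(x)$ denotes the image $\{\pi_L(b):b\in x\}$. *)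

(* Defs.v *)
From HB Require Import structures.
From mathcomp Require Import all_boot all_order all_algebra.
From mathcomp Require Import boolp classical_sets.

Set Implicit Arguments.
Unset Strict Implicit.
Unset Printing Implicit Defensive.

Import Order.TTheory.
Local Open Scope classical_set_scope.
Local Open Scope order_scope.

(* A frame is a complete lattice in which binary meets distribute over
   arbitrary joins.  The one-element frame is allowed.  Only bigjoin is new
   data: the binary and empty joins of the underlying lattice are its
   instances, by uniqueness of least upper bounds. *)
HB.mixin Record TBDistrLattice_isFrame d T of Order.TBDistrLattice d T := {
  bigjoin : set T -> T;
  bigjoin_le : forall (A : set T) (u : T), bigjoin A <= u <-> ubound A u;
  meet_bigjoinr : forall (a : T) (A : set T),
    a `&` bigjoin A = bigjoin [set a `&` b | b in A]
}.

#[short(type="frameType")]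
HB.structure Definition Frame d :=
  { T of TBDistrLattice_isFrame d T & Order.TBDistrLattice d T }.

Section Frame.
Context {d : Order.disp_t} {L : frameType d}.
Implicit Types (a b c : L) (A x y : set L).

Definition bigmeet A : L := bigjoin (lbound A).

Definition pseudocompl a : L := bigjoin [set c | c `&` a = \bot].

Definition rather_below a b : Prop := pseudocompl a `|` b = \top.

(* The scale s is indexed by the rationals of [0, 1]; its values outside this
   interval are irrelevant. *)
Definition completely_below a b : Prop :=
  exists s : rat -> L,
    [/\ s 0%R = a, s 1%R = b &
        forall p q : rat, (0 <= p)%R -> (p < q)%R -> (q <= 1)%R ->
          rather_below (s p) (s q)].

Definition is_successor a c : Prop :=
  a < c /\ ~ exists b, a < b < c.

Definition has_no_successor a : Prop := ~ exists c, is_successor a c.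

Definition is_atom a : Prop := is_successor \bot a.

Definition maximal_elements : set L :=
  [set a | a <> \top /\ forall b, b <> \top -> a <= b -> b = a].

Definition is_filter x : Prop :=
  [/\ x \top,
      forall a b, x a -> a <= b -> x b &
      forall a b, x a -> x b -> x (a `&` b)].

Definition is_proper x : Prop := ~ x \bot.

Definition round_filter x : Prop :=
  is_filter x /\ forall a, x a -> exists2 b, x b & completely_below b a.

Definition regular_filter x : Prop :=
  round_filter x /\ bigjoin [set pseudocompl b | b in x] = \top.

Definition maximal_proper_round_filter x : Prop :=
  [/\ round_filter x, is_proper x &
      forall y, round_filter y -> is_proper y -> x `<=` y -> y = x].

Definition independent (X : set (set L)) : Prop :=
  forall x y, X x -> X y -> x <> y ->
    exists a b, [/\ x a, y b & a `&` b = \bot].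

Definition point_filter a : set L := [set b | ~~ (b <= a)].

End Frame.

Definition completely_regular d (L : frameType d) : Prop :=
  forall a : L, a = bigjoin [set b | completely_below b a].

Definition atomless d (L : frameType d) : Prop := ~ exists a : L, is_atom a.

Section FrameTheory.
Context {d : Order.disp_t} {L : frameType d}.
Implicit Types (a b c : L) (A : set L).

Lemma bigjoin_ub A a : A a -> a <= bigjoin A.
Proof. by move=> Aa; apply: (bigjoin_le A _).1. Qed.

Lemma le_bigmeet A a : a <= bigmeet A <-> lbound A a.
Proof.
split=> [leaA b Ab | lbAa]; last exact: bigjoin_ub.
by apply: (le_trans leaA); apply/bigjoin_le => c; apply.
Qed.

Lemma bigmeet_lb A a : A a -> bigmeet A <= a.
Proof. by move=> Aa; apply: (le_bigmeet A _).1. Qed.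

Lemma no_successor_bigmeet A :
  (forall a, A a -> has_no_successor a) -> has_no_successor (bigmeet A).
Proof.
move=> nsA [b [ltb nb]].
have [a Aa nba] : exists2 a, A a & ~~ (b <= a).
  apply: contrapT => noa; suff: b <= bigmeet A by rewrite (lt_geF ltb).
  apply/le_bigmeet => a Aa; apply: contrapT => /negP nba.
  by apply: noa; exists a.
apply: (nsA a Aa); exists (a `|` b); split.
  by rewrite lt_neqAle leUl andbT eq_sym eq_joinl.
move=> [c /andP[ac cab]].
have le_m_cb : bigmeet A <= c `&` b.
  by rewrite lexI (ltW ltb) (le_trans (bigmeet_lb Aa) (ltW ac)).
have c_eq : c = a `|` (c `&` b).
  by rewrite joinIr (join_idPr (ltW ac)) (meet_idPl (ltW cab)).
apply: nb; exists (c `&` b); apply/andP; split.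
  rewrite lt_neqAle le_m_cb andbT; apply/eqP => eq_m; move: ac.
  by rewrite c_eq -eq_m (join_idPl (bigmeet_lb Aa)) ltxx.
rewrite lt_neqAle leIr andbT; apply/eqP => eq_b; move: cab.
by rewrite c_eq eq_b ltxx.
Qed.

Definition himpl a b : L := bigjoin [set c | c `&` a <= b].

Lemma le_himpl a b c : (c <= himpl a b) <-> (c `&` a <= b).
Proof.
split=> [lec|]; last exact: bigjoin_ub.
apply: (le_trans (leI2 lec (lexx a))).
rewrite meetC meet_bigjoinr; apply/bigjoin_le => _ [e /= ea <-].
by rewrite meetC.
Qed.

Lemma no_successor_himpl a b : has_no_successor b -> has_no_successor (himpl a b).
Proof.
move=> nsb [c [ltc nc]]; apply: nsb; exists (b `|` (c `&` a)).
have nca : ~~ (c `&` a <= b).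
  by apply/negP => /le_himpl; rewrite (lt_geF ltc).
split; first by rewrite lt_neqAle leUl andbT eq_sym eq_joinl.
move=> [e /andP[be eca]].
have e_eq : e = b `|` (e `&` (c `&` a)).
  by rewrite joinIr (join_idPr (ltW be)) (meet_idPl (ltW eca)).
have h_le : himpl a b `&` a <= b by apply/le_himpl.
apply: nc; exists (himpl a b `|` (e `&` (c `&` a))); apply/andP; split.
  rewrite lt_neqAle leUl andbT eq_sym eq_joinl.
  apply/negP => /le_himpl le_b; move: be.
  have -> : e = b; last by rewrite ltxx.
  rewrite e_eq; apply: join_l; apply: le_trans le_b.
  by rewrite lexI lexx /= (le_trans (leIr _ _) (leIr _ _)).
have le_c : e `&` (c `&` a) <= c.
  exact: (le_trans (leIr _ _) (leIl _ _)).
rewrite lt_neqAle leUx (ltW ltc) le_c !andbT.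
apply/eqP => c_eq; suff: b `|` (c `&` a) <= e by rewrite (lt_geF eca).
rewrite leUx (ltW be) /= -{1}c_eq meetUl leUx (le_trans h_le (ltW be)) /=.
by rewrite -meetA leIl.
Qed.

End FrameTheory.

(* The pointless part E of L, with the order of L.  It is closed under
   arbitrary meets and under the Heyting implication (no_successor_bigmeet,
   no_successor_himpl), i.e. it is a sublocale; its meets are those of L, and
   its joins are the images under the quotient map of the joins of L. *)
Record pointless_part d (L : frameType d) := PointlessPart {
  pointless_val :> L;
  pointless_valP : `[< has_no_successor pointless_val >]
}.

Section PointlessPart.
Context {d : Order.disp_t} {L : frameType d}.

HB.instance Definition _ := [isSub for @pointless_val d L].
HB.instance Definition _ := [Choice of pointless_part L by <:].
HB.instance Definition _ :=
  [SubChoice_isSubPOrder of pointless_part L by <: with d].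

Let E := pointless_part L.
Implicit Types (e f g : E) (b : L).

Let leE e f : (e <= f) = (pointless_val e <= pointless_val f).
Proof. by []. Qed.

Lemma pointless_noS e : has_no_successor (pointless_val e).
Proof. exact/asboolP/pointless_valP. Qed.

Fact quotient_map_subproof b :
  `[< has_no_successor (bigmeet [set a | has_no_successor a /\ b <= a]) >].
Proof. by apply/asboolP/no_successor_bigmeet => a []. Qed.

Definition quotient_map b : E := PointlessPart (quotient_map_subproof b).

Lemma quotient_map_le b e : (quotient_map b <= e) = (b <= pointless_val e).
Proof.
rewrite leE; apply/idP/idP => [|le_be].
  by apply: le_trans; apply/le_bigmeet => a [].
by apply: bigmeet_lb; split=> //; exact: pointless_noS.
Qed.

Fact meet_subproof e f :
  `[< has_no_successor (pointless_val e `&` pointless_val f) >].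
Proof.
apply/asboolP; have -> : pointless_val e `&` pointless_val f =
    bigmeet [set pointless_val e; pointless_val f].
  apply/eqP; rewrite eq_le; apply/andP; split.
    by apply/le_bigmeet => a [] ->; rewrite ?leIl ?leIr.
  by rewrite lexI; apply/andP; split; apply: bigmeet_lb; [left|right].
by apply: no_successor_bigmeet => a [] ->; exact: pointless_noS.
Qed.

Let meetE e f : E := PointlessPart (meet_subproof e f).
Let joinE e f : E := quotient_map (pointless_val e `|` pointless_val f).

Fact lexI_subproof e f g : (e <= meetE f g) = (e <= f) && (e <= g).
Proof. by rewrite !leE lexI. Qed.

Fact leUx_subproof e f g : (joinE e f <= g) = (e <= g) && (f <= g).
Proof. by rewrite quotient_map_le leUx. Qed.

HB.instance Definition _ :=
  @Order.POrder_isMeetSemilattice.Build d (pointless_part L) meetE lexI_subproof.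
HB.instance Definition _ :=
  @Order.POrder_isJoinSemilattice.Build d (pointless_part L) joinE leUx_subproof.

Let himplE_subproof b e : `[< has_no_successor (himpl b (pointless_val e)) >].
Proof. exact/asboolP/no_successor_himpl/pointless_noS. Qed.

Lemma meet_quotient_map_le b e f :
  (forall c, c <= b -> c `&` pointless_val e <= pointless_val f) ->
  quotient_map b `&` e <= f.
Proof.
move=> bef; rewrite leE; apply/le_himpl.
rewrite -[himpl _ _]/(pointless_val (PointlessPart (himplE_subproof _ _))) -leE.
by rewrite quotient_map_le; apply/le_himpl/bef.
Qed.

Fact meetUl_subproof :
  @left_distributive E E (@Order.meet d _) (@Order.join d _).
Proof.
move=> e f g; apply/eqP; rewrite eq_le; apply/andP; split; last first.
  by rewrite leUx !leI2 ?leUl ?leUr.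
apply: meet_quotient_map_le => c lec.
apply: (le_trans (leI2 lec (lexx _))).
by rewrite meetUl leUx; apply/andP; split; [have := leUl (e `&` g) (f `&` g) |
  have := leUr (f `&` g) (e `&` g)]; rewrite leE.
Qed.

HB.instance Definition _ :=
  @Order.Lattice_Meet_isDistrLattice.Build d (pointless_part L) meetUl_subproof.

Fact le0x_subproof e : quotient_map \bot <= e.
Proof. by rewrite quotient_map_le le0x. Qed.

Fact lex1_subproof e : e <= quotient_map \top.
Proof. by rewrite leE; apply: (le_trans (lex1 _)); apply/le_bigmeet => a []. Qed.

HB.instance Definition _ :=
  @Order.hasBottom.Build d (pointless_part L) _ le0x_subproof.
HB.instance Definition _ :=
  @Order.hasTop.Build d (pointless_part L) _ lex1_subproof.

Let bigjoinE (A : set E) : E :=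
  quotient_map (bigjoin [set pointless_val e | e in A]).

Fact bigjoin_le_subproof (A : set E) (u : E) : bigjoinE A <= u <-> ubound A u.
Proof.
rewrite quotient_map_le; split=> [/bigjoin_le ubu e Ae | ubu].
  by rewrite leE; apply: ubu; exists e.
by apply/bigjoin_le => _ [e Ae <-]; rewrite -leE; exact: ubu.
Qed.

Fact meet_bigjoinr_subproof (e : E) (A : set E) :
  e `&` bigjoinE A = bigjoinE [set e `&` f | f in A].
Proof.
apply/eqP; rewrite eq_le; apply/andP; split; last first.
  apply/bigjoin_le_subproof => _ [f Af <-]; rewrite leI2 //.
  exact: (bigjoin_le_subproof A _).1.
rewrite meetC; apply: meet_quotient_map_le => c lec.
apply: (le_trans (leI2 lec (lexx _))); rewrite meetC meet_bigjoinr.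
apply/bigjoin_le => _ [_ [f Af <-] <-].
have : e `&` f <= bigjoinE [set e `&` f | f in A].
  by apply: (bigjoin_le_subproof _ _).1 => //; exists f.
by rewrite leE.
Qed.

HB.instance Definition _ := @TBDistrLattice_isFrame.Build d (pointless_part L)
  bigjoinE bigjoin_le_subproof meet_bigjoinr_subproof.

Definition quotient_image (x : set L) : set (pointless_part L) :=
  [set quotient_map b | b in x].

End PointlessPart.

(* Main.v *)
Require Import Defs.
From HB Require Import structures.
From mathcomp Require Import all_boot all_order all_algebra.
From mathcomp Require Import boolp classical_sets.
From mathcomp Require Import lra.

Set Implicit Arguments.
Unset Strict Implicit.
Unset Printing Implicit Defensive.

Import Order.TTheory.
Local Open Scope classical_set_scope.
Local Open Scope order_scope.

(** The quotient map [pi : L -> E] is a frame homomorphism, so it carries [<<]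
    (completely below) to [<<] and sends [b^*] below [(pi b)^*].  Since [L] is
    atomless, bottom lies in [E], so [pi] is dense: [pi b] is bottom only if
    [b] is.  Hence images of proper round filters are proper round filters,
    and the image of [x] is regular as soon as [pi] sends
    [c = \/ {b^* | b in x}] to top ([regular_quotient_image]).  If [x] is
    itself regular then [c] is top, which settles the first claim.

    If [x] is a maximal proper round filter, the point is that [c] is either
    top or a maximal element ([maximal_round_joins_top]).  For take any [e]
    not below [c]; complete regularity gives [u << v << e] with [u] not below
    [c].  No member of [x] is disjoint from [u], so [x] together with the
    elements [u] is completely below generates a proper round filter, and by
    maximality [v] is in [x].  Then [v^* <= c], while [v << e] says that
    [v^*] and [e] join to top.  A maximal element has the successor top, so it
    is not in [E] and [pi] sends it to top.

    For a maximal element [a], the filter [point_filter a] is a maximal proper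
    round filter, so the second claim applies to it; two distinct maximal
    elements are separated by an element [c] and its pseudocomplement, which
    gives independence. *)

(** * Pseudocomplements and the completely below relation *)

Section CompletelyBelow.
Context {d : Order.disp_t} {L : frameType d}.
Implicit Types (a b c u v : L) (x y : set L).

Lemma le_pseudocompl a c : (c <= pseudocompl a) <-> (c `&` a = \bot).
Proof.
split=> [lec|]; last exact: bigjoin_ub.
apply/eqP; rewrite -lex0; apply: (le_trans (leI2 lec (lexx a))).
rewrite meetC meet_bigjoinr; apply/bigjoin_le => _ [e /= ea <-].
by rewrite meetC ea.
Qed.

Lemma meet_pseudocompl a : pseudocompl a `&` a = \bot.
Proof. exact/le_pseudocompl. Qed.

Lemma pseudocompl_anti a b : a <= b -> pseudocompl b <= pseudocompl a.
Proof.
move=> leab; apply/le_pseudocompl/eqP; rewrite -lex0 -(meet_pseudocompl b).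
exact: leI2.
Qed.

Lemma rather_below_le a b : rather_below a b -> a <= b.
Proof.
move=> rab; rewrite -[a]meet1x -rab meetUl meet_pseudocompl join0x.
exact: leIl.
Qed.

Lemma rather_below_trans_le a b c : rather_below a b -> b <= c -> rather_below a c.
Proof. by move=> rab lebc; apply/eqP; rewrite -le1x -rab leU2. Qed.

Lemma rather_below_meet a b u v :
  rather_below a u -> rather_below b v -> rather_below (a `&` b) (u `&` v).
Proof.
move=> rau rbv; apply/eqP; rewrite -le1x joinIr lexI; apply/andP; split.
  by rewrite -rau leU2 // pseudocompl_anti // leIl.
by rewrite -rbv leU2 // pseudocompl_anti // leIr.
Qed.

Lemma completely_below_rather a b : completely_below a b -> rather_below a b.
Proof. by case=> s [<- <- rs]; apply: rs. Qed.

Lemma completely_below_le a b : completely_below a b -> a <= b.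
Proof. by move/completely_below_rather/rather_below_le. Qed.

Lemma completely_below_trans_le a b c :
  completely_below a b -> b <= c -> completely_below a c.
Proof.
case=> s [sa sb rs] lebc.
exists (fun p => if (p < 1)%R then s p else c); split=> // p q p0 pq q1.
have -> : (p < 1)%R by lra.
case: ifP => [_|/negbT qn1]; first exact: rs.
have q_eq : q = 1%R by lra.
by apply: rather_below_trans_le lebc; rewrite -sb -q_eq; exact: rs.
Qed.

Lemma completely_below_meet a b u v :
  completely_below a u -> completely_below b v ->
  completely_below (a `&` b) (u `&` v).
Proof.
move=> [s [<- <- rs]] [t [<- <- rt]].
exists (fun p => s p `&` t p); split=> // p q p0 pq q1.
by apply: rather_below_meet; [exact: rs|exact: rt].
Qed.

(** Any interior value of a scale from [a] to [b] interpolates, since both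
    halves of the scale can be stretched back to the unit interval. *)
Lemma completely_below_interpolate a b :
  completely_below a b -> exists2 c, completely_below a c & completely_below c b.
Proof.
case=> s [<- <- rs]; exists (s (1 / 2)%R).
  exists (fun p => s (p / 2)%R); split=> [||p q p0 pq q1]; last by apply: rs; lra.
    by congr s; lra.
  by [].
exists (fun p => s ((1 + p) / 2)%R); split=> [||p q p0 pq q1].
- by congr s; lra.
- by congr s; lra.
- by apply: rs; lra.
Qed.

Lemma completely_below_separation (regL : completely_regular L) a b :
  ~~ (b <= a) -> exists2 c, completely_below c b & ~~ (c <= a).
Proof.
move=> nba; apply: contrapT => noc; move/negP: nba; apply.
rewrite (regL b); apply/bigjoin_le => c cb; apply: contrapT => /negP nca.
by apply: noc; exists c.
Qed.

End CompletelyBelow.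

(** * Maximal proper round filters *)

Section MaximalRoundFilters.
Context {d : Order.disp_t} {L : frameType d}.
Implicit Types (a b c u v : L) (x y : set L).

(** The filter generated by [x] and the elements above [u] in the completely
    below relation is again round, by interpolation, and it is proper because
    [u] meets every member of [x]; so it equals [x]. *)
Lemma maximal_round_mem x u v :
  maximal_proper_round_filter x -> completely_below u v ->
  (forall b, x b -> b `&` u <> \bot) -> x v.
Proof.
move=> [[[x1 xup xI] xround] _ xmax] uv meets_u.
pose y : set L :=
  [set w | exists b v', [/\ x b, completely_below u v' & b `&` v' <= w]].
have <- : y = x; last by exists \top, v; rewrite /= meet1x; split.
apply: xmax => [||b xb]; last by exists b, v; split; rewrite // leIl.
- split; first split.
  + by exists \top, v; rewrite lex1; split.
  + move=> a b [c [v' [xc uv' le_a]]] leab; exists c, v'; split=> //.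
    exact: le_trans leab.
  + move=> a b [a1 [v1 [xa1 uv1 le_a]]] [b1 [v2 [xb1 uv2 le_b]]].
    exists (a1 `&` b1), (v1 `&` v2); split; first exact: xI.
      by rewrite -[u]meetxx; exact: completely_below_meet.
    by rewrite meetACA leI2.
  + move=> a [b [w [xb uw le_a]]].
    have [b' xb' b'b] := xround b xb.
    have [w' uw' w'w] := completely_below_interpolate uw.
    exists (b' `&` w'); first by exists b', w'; split.
    exact: (completely_below_trans_le (completely_below_meet b'b w'w)).
- move=> [b [w [xb uw le0]]]; apply: (meets_u b xb).
  apply/eqP; rewrite -lex0; apply: le_trans le0.
  by apply: leI2 => //; exact: completely_below_le.
Qed.

(** Says that [c] is top or a maximal element.  The reason is that with
    [u << v << e] and [u] not below [c], the element [v] falls into [x], so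
    that [v^*] is one of the elements joined in [c]. *)
Lemma maximal_round_joins_top (regL : completely_regular L) x e :
  maximal_proper_round_filter x ->
  let c := bigjoin [set pseudocompl b | b in x] in
  ~~ (e <= c) -> c `|` e = \top.
Proof.
move=> xmax c nec.
have [u ue nuc] := completely_below_separation regL nec.
have [v uv ve] := completely_below_interpolate ue.
have xv : x v.
  apply: maximal_round_mem uv _ => // b xb bu0; move/negP: nuc; apply.
  apply: (@le_trans _ _ (pseudocompl b)); first by apply/le_pseudocompl; rewrite meetC.
  by apply: bigjoin_ub; exists b.
apply/eqP; rewrite -le1x -(completely_below_rather ve) leU2 //.
by apply: bigjoin_ub; exists v.
Qed.

Lemma maximal_join_top a b : maximal_elements a -> ~~ (b <= a) -> a `|` b = \top.
Proof.
move=> [_ amax] nba; apply: contrapT => ab1; move/negP: nba; apply.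
by rewrite -[leRHS](amax _ ab1 (leUl a b)) leUr.
Qed.

Lemma point_filter_maximal (regL : completely_regular L) a :
  maximal_elements a -> maximal_proper_round_filter (point_filter a).
Proof.
move=> amax; have [a1 _] := amax.
have n1a : ~~ (\top <= a) by rewrite le1x; apply/eqP.
split.
- split; first split=> //.
  + by move=> b c /= /negP nba lebc; apply/negP => lea; exact/nba/(le_trans lebc).
  + move=> b c /(maximal_join_top amax) ab /(maximal_join_top amax) ac.
    apply/negP => lea; apply: a1.
    by rewrite -(join_l lea) joinIr ab ac meetxx.
  + by move=> b nba; have [c cb nca] := completely_below_separation regL nba; exists c.
- by rewrite /is_proper /point_filter /= le0x.
- move=> y [[_ _ yI] yround] y0 sub; apply/seteqP; split=> // b yb.
  apply/negP => leba; have [c yc /completely_below_rather cb] := yround b yb.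
  apply: y0; rewrite -(meet_pseudocompl c); apply: yI yc; apply: sub.
  apply/negP => le_a; apply: a1; apply/eqP.
  by rewrite -le1x -cb leUx le_a.
Qed.

Lemma maximal_elements_separation (regL : completely_regular L) a b :
  maximal_elements a -> maximal_elements b -> a <> b ->
  exists c e, [/\ point_filter a c, point_filter b e & c `&` e = \bot].
Proof.
move=> amax [b1 bmax] neq_ab.
have nba : ~~ (b <= a).
  by apply/negP => leba; apply/neq_ab/bmax => //; case: amax.
have [c /completely_below_rather cb nca] := completely_below_separation regL nba.
exists c, (pseudocompl c); split=> //; last by rewrite meetC meet_pseudocompl.
apply/negP => le_b; apply: b1; apply/eqP.
by rewrite -le1x -cb leUx le_b /=.
Qed.

End MaximalRoundFilters.

(** * The quotient map onto the pointless part *)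

Section QuotientMap.
Context {d : Order.disp_t} {L : frameType d}.
Implicit Types (a b c : L) (e : pointless_part L) (x : set L).

Lemma le_quotient_map b : b <= pointless_val (quotient_map b).
Proof. by rewrite -quotient_map_le. Qed.

Lemma quotient_map_mono a b : a <= b -> quotient_map a <= quotient_map b.
Proof.
by move=> leab; rewrite quotient_map_le (le_trans leab) ?le_quotient_map.
Qed.

Lemma quotient_map_val e : quotient_map (pointless_val e) = e.
Proof.
by apply/eqP; rewrite eq_le quotient_map_le lexx; exact: le_quotient_map.
Qed.

Lemma quotient_mapU a b : quotient_map (a `|` b) = quotient_map a `|` quotient_map b.
Proof.
apply/eqP; rewrite eq_le quotient_map_le !leUx -!quotient_map_le leUl leUr /=.
by rewrite !quotient_map_mono ?leUl ?leUr.
Qed.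

(** Taking the two arguments off one at a time reduces this to [c <= a]
    implies [c `&` b <= quotient_map (a `&` b)]; it works because [E] is closed
    under the Heyting implication. *)
Lemma quotient_mapI a b : quotient_map (a `&` b) = quotient_map a `&` quotient_map b.
Proof.
apply/eqP; rewrite eq_le lexI !quotient_map_mono ?leIl ?leIr //=.
apply: meet_quotient_map_le => c leca; rewrite meetC; apply/le_himpl.
have ns : has_no_successor (himpl c (pointless_val (quotient_map (a `&` b)))).
  exact/no_successor_himpl/pointless_noS.
(* Seen as an element of [E], the implication can be compared with
   [quotient_map b] through the universal property of the quotient map. *)
rewrite -[himpl _ _]/(pointless_val (PointlessPart (introT (asboolP _) ns))).
rewrite -[X in is_true X]/(quotient_map b <= _) quotient_map_le.
apply/le_himpl; rewrite meetC; apply: le_trans (le_quotient_map _).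
exact: leI2.
Qed.

Lemma quotient_map0 : quotient_map \bot = \bot :> pointless_part L.
Proof. by []. Qed.

Lemma quotient_map1 : quotient_map \top = \top :> pointless_part L.
Proof. by []. Qed.

Lemma quotient_map_pseudocompl b :
  quotient_map (pseudocompl b) <= pseudocompl (quotient_map b).
Proof.
by apply/le_pseudocompl; rewrite -quotient_mapI meet_pseudocompl quotient_map0.
Qed.

Lemma quotient_map_completely_below a b :
  completely_below a b -> completely_below (quotient_map a) (quotient_map b).
Proof.
case=> s [<- <- rs]; exists (quotient_map \o s); split=> // p q p0 pq q1 /=.
apply/eqP; rewrite -le1x -quotient_map1 -(rs p q p0 pq q1) quotient_mapU leU2 //.
exact: quotient_map_pseudocompl.
Qed.

(** Density: in an atomless frame bottom has no successor, so it is itself an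
    element of [E]. *)
Lemma quotient_map_eq0 (atomlessL : atomless L) b : quotient_map b = \bot -> b = \bot.
Proof.
move=> b0; apply/eqP; rewrite -lex0.
have ns : has_no_successor (\bot : L) by [].
rewrite -[leRHS]/(pointless_val (PointlessPart (introT (asboolP _) ns))).
by rewrite -quotient_map_le b0 le0x.
Qed.

(** A maximal element has the successor top, hence is not in [E], and the only
    element strictly above it is top. *)
Lemma quotient_map_maximal a : maximal_elements a -> quotient_map a = \top.
Proof.
move=> [a1 amax]; suff q1 : pointless_val (quotient_map a) = \top.
  by rewrite -[LHS]quotient_map_val q1 quotient_map1.
apply: contrapT => qa1; have qa := amax _ qa1 (le_quotient_map a).
have := @pointless_noS _ _ (quotient_map a); rewrite qa; apply; exists \top; split.
  by rewrite lt_neqAle lex1 andbT; apply/eqP.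
move=> [b /andP[ab b1]]; have b_eq : b = a.
  by apply: amax (ltW ab) => b_top; rewrite b_top ltxx in b1.
by rewrite b_eq ltxx in ab.
Qed.

Lemma proper_quotient_image (atomlessL : atomless L) x :
  is_proper x -> is_proper (quotient_image x).
Proof. by move=> x0 [b xb /(quotient_map_eq0 atomlessL) b0]; apply: x0; rewrite -b0. Qed.

Lemma round_quotient_image x : round_filter x -> round_filter (quotient_image x).
Proof.
move=> [[x1 xup xI] xround]; split; first split.
- by exists \top.
- move=> _ e [b xb <-]; rewrite quotient_map_le => be.
  by exists (pointless_val e); [exact: xup be|exact: quotient_map_val].
- move=> _ _ [a xa <-] [b xb <-]; exists (a `&` b); first exact: xI.
  by rewrite quotient_mapI.
- move=> _ [a xa <-]; have [b xb ba] := xround a xa.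
  by exists (quotient_map b); [exists b|exact: quotient_map_completely_below].
Qed.

Lemma regular_quotient_image x : round_filter x ->
  quotient_map (bigjoin [set pseudocompl b | b in x]) = \top ->
  regular_filter (quotient_image x).
Proof.
move=> xround q1; split; first exact: round_quotient_image.
apply/eqP; rewrite -le1x -q1 quotient_map_le; apply/bigjoin_le => _ [b xb <-].
rewrite -quotient_map_le; apply: (le_trans (quotient_map_pseudocompl b)).
by apply: bigjoin_ub; exists (quotient_map b) => //; exists b.
Qed.

(** The filter [x] need not be regular, but the join of the pseudocomplements
    of its members can only fail to be top by being maximal, and the quotient
    map sends it to top in both cases. *)
Lemma maximal_round_quotient_image (regL : completely_regular L)
    (atomlessL : atomless L) x :
  maximal_proper_round_filter x ->
  is_proper (quotient_image x) /\ regular_filter (quotient_image x).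
Proof.
move=> xmax; have [xround x0 _] := xmax.
split; first exact: proper_quotient_image.
apply: regular_quotient_image => //.
have joins (e : L) := maximal_round_joins_top regL (e := e) xmax.
move: (bigjoin _) joins => /= c joins.
case: (pselect (c = \top)) => [-> //|c1]; apply: quotient_map_maximal; split=> //.
move=> e e1 lece; apply/eqP; rewrite eq_le lece andbT.
by apply: contrapT => /negP/joins; rewrite (join_r lece).
Qed.

End QuotientMap.

Theorem lemma6p2p2 (d : Order.disp_t) (L : frameType d)
    (regL : completely_regular L) (atomlessL : atomless L) :
  [/\ forall x : set L, is_proper x -> regular_filter x ->
        is_proper (quotient_image x) /\ regular_filter (quotient_image x),
      forall x : set L, maximal_proper_round_filter x ->
        is_proper (quotient_image x) /\ regular_filter (quotient_image x)
    & forall A : set L, A `<=` maximal_elements ->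
        let X := [set quotient_image (point_filter a) | a in A] in
        independent X /\ forall y, X y -> is_proper y /\ regular_filter y].
Proof.
split=> [x x0 [xround xreg] | x | A Amax X].
- split; first exact: proper_quotient_image.
  by apply: regular_quotient_image; rewrite // xreg.
- exact: maximal_round_quotient_image.
- split=> [_ _ [a Aa <-] [b Ab <-] neq | _ [a Aa <-]].
    have neq_ab : a <> b by move=> eq_ab; apply: neq; rewrite eq_ab.
    have [c [e [ac be ce0]]] :=
      maximal_elements_separation regL (Amax a Aa) (Amax b Ab) neq_ab.
    exists (quotient_map c), (quotient_map e); split; [by exists c|by exists e|].
    by rewrite -quotient_mapI ce0 quotient_map0.
  exact/maximal_round_quotient_image/point_filter_maximal/Amax.
Qed.
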